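(* Let $m\ge 2$ be an integer, let $x_1,\ldots,x_m\in\mathcal{H}$ be affinely independent, and let $S=\{x_1,\ldots,x_m\}$. Then $CC(S)\in\mathcal{H}$, which means that $CC(S)$ is the unique point satisfying the following two conditions: (i) $CC(S)\in\operatorname{aff}(S)$, and (ii) $\{\|CC(S)-s\| \mid s\in S\}$ is a singleton. Moreover, $$CC(S)=x_1+\frac12\,(x_2-x_1,\ldots,x_m-x_1)\,G(x_2-x_1,\ldots,x_m-x_1)^{-1}\begin{pmatrix}\|x_2-x_1\|^2\\ \vdots\\ \|x_m-x_1\|^2\end{pmatrix}.$$
   Context: $\mathcal{H}$ is a real Hilbert space with inner product $\langle\cdot,\cdot\rangle$ and induced norm $\|\cdot\|$. $\operatorname{aff}(S)$ denotes the affine hull of $S$. Vectors $x_1,\ldots,x_m$ are affinely independent if $\operatorname{aff}\{x_1,\ldots,x_m\}$ has dimension $m-1$ (equivalently, $x_2-x_1,\ldots,x_m-x_1$ are linearly independent). Circumcenter: for a nonempty finite set $S\subseteq\mathcal{H}$ there is at most one point $p\in\mathcal{H}$ such that $p\in\operatorname{aff}(S)$ and $\{\|p-s\|\mid s\in S\}$ is a singleton. $CC(S)$ is defined to be this point $p$ if it exists, and $CC(S)=\varnothing$ otherwise; ''$CC(S)\in\mathcal{H}$'' means the point exists. Gram matrix: for $a_1,\ldots,a_n\in\mathcal{H}$, $G(a_1,\ldots,a_n)$ is the $n\times n$ real matrix with $(i,j)$ entry $\langle a_i,a_j\rangle$. For vectors $v_1,\ldots,v_n\in\mathcal{H}$ and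 $c=(c_1,\ldots,c_n)^{\intercal}\in\mathbb{R}^n$, the product $(v_1,\ldots,v_n)\,c$ means $c_1v_1+\cdots+c_nv_n$. *)

(* Defs.v *)
From HB Require Import structures.
From mathcomp Require Import all_boot all_order all_algebra.
From mathcomp Require Import all_classical all_reals all_analysis.
Set Implicit Arguments.
Unset Strict Implicit.
Unset Printing Implicit Defensive.
Import Order.TTheory GRing.Theory Num.Theory.
Import numFieldNormedType.Exports.
Local Open Scope classical_set_scope.
Local Open Scope ring_scope.

Section Affine.
Context {R : realType} {V : lmodType R}.
Implicit Types (A S L : set V).

Definition affine_set A : Prop :=
  forall (t : R) (u v : V), A u -> A v -> A ((1 - t) *: u + t *: v).

Definition aff S : set V := smallest affine_set S.

(* [lincomb v c] is the product (v_1, ..., v_n) c *)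
Definition lincomb n (v : 'I_n -> V) (c : 'cV[R]_n) : V :=
  \sum_(i < n) c i 0 *: v i.

Definition lin_independent n (v : 'I_n -> V) : Prop :=
  forall c : 'cV[R]_n, lincomb v c = 0 -> c = 0.

(* L is a linear subspace of dimension d: it has a basis with d elements *)
Definition has_dim L (d : nat) : Prop :=
  exists2 b : 'I_d -> V, lin_independent b & L = range (lincomb b).

(* The dimension of a nonempty affine set A is that of its direction space
   A - A. For A empty, A - A is empty and no d satisfies this. *)
Definition has_affine_dim A (d : nat) : Prop :=
  has_dim [set u - v | u in A & v in A] d.

Definition aff_independent m (x : 'I_m -> V) : Prop :=
  has_affine_dim (aff (range x)) m.-1.

End Affine.

Section Circumcenter.
Context {R : realType} {H : normedModType R}.

Definition is_circumcenter (S : set H) (p : H) : Prop :=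
  aff S p /\ exists r : R, [set `|p - s| | s in S] = [set r].

(* [None] plays the role of the value "emptyset" of CC(S). *)
Definition CC (S : set H) : option H :=
  if pselect (exists p, is_circumcenter S p) is left ex_p
  then Some (projT1 (cid ex_p)) else None.

End Circumcenter.

Definition gram {R : realType} {H : lmodType R} (dot : {dot H for idfun})
  n (a : 'I_n -> H) : 'M[R]_n := \matrix_(i < n, j < n) dot (a i) (a j).

(* Main.v *)
Require Import Defs.
From HB Require Import structures.
From mathcomp Require Import all_boot all_order all_algebra.
From mathcomp Require Import all_classical all_reals all_analysis.
From mathcomp Require Import ring.
Set Implicit Arguments.
Unset Strict Implicit.
Unset Printing Implicit Defensive.
Import Order.TTheory GRing.Theory Num.Theory.
Import numFieldNormedType.Exports.
Local Open Scope classical_set_scope.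
Local Open Scope ring_scope.

(** Write d_i = x_{i+1} - x_1 and G for the Gram matrix of the d_i. Every point
    of the affine hull has the form x_1 + w with w a linear combination of the
    d_i. It is equidistant from x_1 and x_{i+1} iff |w|^2 = |w - d_i|^2, and
    when the right-hand side is expanded the terms |w|^2 cancel: what is left
    is the equation 2 <d_i, w> = |d_i|^2, which is linear in w. For
    w = (d_1, ..., d_n) c the numbers <d_i, w> are the entries of G c, so the
    circumcenters are exactly the points x_1 + (d_1, ..., d_n) c for the
    solutions c of the square system G c = 1/2 (|d_i|^2)_i
    ([is_circumcenter_rangeP]).

    It remains to see that G is invertible. If G c = 0, then w = (d_1, ..., d_n) c
    is orthogonal to each d_i, hence to itself, so w = 0; and then c = 0 because
    the d_i are linearly independent ([gram_unit]). That independence is what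
    affine independence gives: the direction space of the affine hull is
    spanned by the n vectors d_i and has dimension n
    ([lin_independent_spanning]). *)

(** * Linear combinations *)

Section LinearCombinations.
Context {R : realType} {V : lmodType R}.

Lemma lincombD n (v : 'I_n -> V) (a b : 'cV[R]_n) :
  lincomb v (a + b) = lincomb v a + lincomb v b.
Proof. by rewrite -big_split; apply: eq_bigr => i _; rewrite mxE scalerDl. Qed.

Lemma lincombZ n (v : 'I_n -> V) (t : R) (a : 'cV[R]_n) :
  lincomb v (t *: a) = t *: lincomb v a.
Proof. by rewrite scaler_sumr; apply: eq_bigr => i _; rewrite mxE scalerA. Qed.

Lemma lincomb0 n (v : 'I_n -> V) : lincomb v 0 = 0.
Proof. by have := lincombZ v 0 0; rewrite !scale0r. Qed.

Lemma lincombB n (v : 'I_n -> V) (a b : 'cV[R]_n) :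
  lincomb v (a - b) = lincomb v a - lincomb v b.
Proof. by rewrite lincombD -(scaleN1r b) lincombZ scaleN1r. Qed.

Lemma lincomb_delta n (v : 'I_n -> V) i : lincomb v (delta_mx i 0) = v i.
Proof.
rewrite /lincomb (bigD1 i)//= mxE !eqxx scale1r big1 ?addr0// => j ji.
by rewrite mxE (negPf ji) scale0r.
Qed.

Lemma lincomb_inj n (v : 'I_n -> V) :
  lin_independent v -> injective (lincomb v).
Proof.
move=> v_indep a b ab; apply/eqP; rewrite -subr_eq0; apply/eqP.
by apply: v_indep; rewrite lincombB ab subrr.
Qed.

Lemma lincomb_mulmx n k (v : 'I_n -> V) (w : 'I_k -> V) (M : 'M[R]_(n, k)) c :
  (forall j, w j = lincomb v (col j M)) -> lincomb w c = lincomb v (M *m c).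
Proof.
move=> wE; rewrite /lincomb.
under eq_bigr do rewrite wE scaler_sumr.
rewrite exchange_big; apply: eq_bigr => i _.
rewrite mxE scaler_suml; apply: eq_bigr => j _.
by rewrite mxE scalerA mulrC.
Qed.

(** The matrices that express [v] in the basis and the basis in [v] are square
    of size [n]; their product in one order is 1 because the basis is free, so
    it is 1 in the other order, and the kernel of [lincomb v] is trivial. *)
Lemma lin_independent_spanning n (v : 'I_n -> V) :
  has_dim (range (lincomb v)) n -> lin_independent v.
Proof.
case=> b b_indep spanE c vc0.
have /choice [f fE] i : exists a, b i = lincomb v a.
  have : range (lincomb v) (b i).
    by rewrite spanE; exists (delta_mx i 0) => //; exact: lincomb_delta.
  by case=> a _ <-; exists a.
have /choice [g gE] i : exists a, v i = lincomb b a.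
  have : range (lincomb b) (v i).
    by rewrite -spanE; exists (delta_mx i 0) => //; exact: lincomb_delta.
  by case=> a _ <-; exists a.
pose N : 'M[R]_n := \matrix_(i, j) f j i 0.
pose M : 'M[R]_n := \matrix_(i, j) g j i 0.
have bE j : b j = lincomb v (col j N).
  by rewrite fE; congr lincomb; apply/colP => i; rewrite !mxE.
have vE j : v j = lincomb b (col j M).
  by rewrite gE; congr lincomb; apply/colP => i; rewrite !mxE.
have MN1 : M *m N = 1%:M.
  suff MNj j : col j (M *m N) = col j 1%:M.
    by apply/matrixP => i j; have /colP/(_ i) := MNj j; rewrite !mxE.
  apply: (lincomb_inj b_indep).
  by rewrite colE -mulmxA -colE -(lincomb_mulmx _ vE) -bE col1 lincomb_delta.
rewrite -[c]mul1mx -(mulmx1C MN1) -mulmxA (b_indep (M *m c)) ?mulmx0//.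
by rewrite -(lincomb_mulmx _ vE).
Qed.

End LinearCombinations.

(** * Affine hulls of finite families *)

Section AffineHulls.
Context {R : realType} {V : lmodType R}.
Implicit Types (A S : set V) (p u v : V).

Lemma affine_set_aff S : affine_set (aff S).
Proof.
move=> t u v Su Sv A [Aaff SA].
exact: Aaff (Su A (conj Aaff SA)) (Sv A (conj Aaff SA)).
Qed.

Lemma affine_setZ A p u (t : R) :
  affine_set A -> A p -> A (p + u) -> A (p + t *: u).
Proof.
move=> Aaff Ap Apu; suff -> : p + t *: u = (1 - t) *: p + t *: (p + u).
  exact: Aaff.
by rewrite scalerDr addrA -scalerDl subrK scale1r.
Qed.

(** Over the reals 2 is invertible, so [p + (u + v)] is reached from [p] by
    doubling the way to the midpoint of [p + u] and [p + v]. *)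
Lemma affine_setD A p u v :
  affine_set A -> A p -> A (p + u) -> A (p + v) -> A (p + (u + v)).
Proof.
move=> Aaff Ap Apu Apv.
have two0 : (2 : R) != 0 by rewrite pnatr_eq0.
rewrite -[u + v]scale1r -(mulfV two0) -scalerA; apply: affine_setZ => //.
suff -> : p + 2^-1 *: (u + v) = (1 - 2^-1) *: (p + u) + 2^-1 *: (p + v).
  exact: Aaff.
have -> : 1 - 2^-1 = 2^-1 :> R.
  by rewrite {1}[1 in LHS]splitr mul1r addrK.
rewrite -scalerDr addrACA [in RHS]scalerDr -mulr2n -[p *+ 2]scaler_nat scalerA.
by rewrite mulVf// scale1r.
Qed.

Lemma aff_rangeE n (x : 'I_n.+1 -> V) :
  let d := fun i : 'I_n => x (lift ord0 i) - x ord0 in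
  aff (range x) = [set x ord0 + lincomb d c | c in setT].
Proof.
move=> d; apply/seteqP; split.
  apply: smallest_sub => [t _ _ [a _ <-] [b _ <-]|_ [i _ <-]].
    exists ((1 - t) *: a + t *: b) => //.
    rewrite lincombD !lincombZ !scalerDr addrACA -scalerDl subrK.
    by rewrite scale1r.
  case: (unliftP ord0 i) => [j ->|->].
    by exists (delta_mx j 0) => //; rewrite lincomb_delta addrC subrK.
  by exists 0 => //; rewrite lincomb0 addr0.
move=> _ [c _ <-].
have Aaff := @affine_set_aff (range x).
have Ax i : aff (range x) (x i) by apply: sub_gen_smallest; exists i.
apply: (big_ind (fun w => aff (range x) (x ord0 + w))) => [|u v|i _].
- by rewrite addr0.
- exact: affine_setD.
- apply: (affine_setZ _ Aaff) => //; by rewrite addrC subrK.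
Qed.

Lemma aff_independent_lin n (x : 'I_n.+1 -> V) : aff_independent x ->
  lin_independent (fun i : 'I_n => x (lift ord0 i) - x ord0).
Proof.
set d := fun i => _; move=> x_indep; apply: lin_independent_spanning.
suff <- : [set u - v | u in aff (range x) & v in aff (range x)]
          = range (lincomb d) by [].
rewrite (aff_rangeE x); apply/seteqP; split.
  move=> _ [_ [a _ <-] [_ [b _ <-] <-]]; exists (a - b) => //.
  by rewrite lincombB opprD addrACA subrr add0r.
move=> _ [c _ <-]; exists (x ord0 + lincomb d c); first by exists c.
exists (x ord0); first by exists 0 => //; rewrite lincomb0 addr0.
by rewrite addrC addKr.
Qed.

End AffineHulls.

(** * Gram matrices *)

Section GramMatrices.
Context {R : realType} {V : lmodType R} (dot : {dot V for idfun}).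

Lemma dot_sym (u v : V) : dot u v = dot v u.
Proof. by rewrite hermC mul1r. Qed.

Lemma dot_eq0 (u : V) : dot u u = 0 -> u = 0.
Proof.
move=> uu0; apply/eqP/contraT => /(neq0_dnorm_gt0 (s := dot)).
by rewrite uu0 ltxx.
Qed.

Lemma gram_mulmx n (v : 'I_n -> V) (c : 'cV[R]_n) i :
  (gram dot v *m c) i 0 = dot (v i) (lincomb v c).
Proof.
rewrite mxE linear_sumr; apply: eq_bigr => j _.
by rewrite mxE linearZr_LR/= mulrC.
Qed.

(** For [c] in the kernel of the Gram matrix, [w := lincomb v c] is orthogonal
    to every [v i], and therefore to itself. *)
Lemma gram_unit n (v : 'I_n -> V) :
  lin_independent v -> gram dot v \in unitmx.
Proof.
move=> v_indep; rewrite -unitmx_tr -row_free_unit -kermx_eq0.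
apply/eqP/row_matrixP => i; rewrite row0.
set r := row i _.
have Gr0 : gram dot v *m r^T = 0.
  apply: (can_inj trmxK); rewrite trmx_mul trmxK trmx0.
  by rewrite /r -row_mul mulmx_ker row0.
apply: (can_inj trmxK); rewrite trmx0; apply: v_indep; apply: dot_eq0.
rewrite {1}/lincomb linear_sumlz big1// => j _.
by rewrite linearZl_LR/= -gram_mulmx Gr0 [X in _ * X]mxE mulr0.
Qed.

End GramMatrices.

(** * Circumcenters *)

Section Circumcenters.
Context {R : realType} {H : normedModType R} (dot : {dot H for idfun}).
Hypothesis norm_dot : forall u : H, `|u| = Num.sqrt (dot u u).

Lemma sqr_norm_dot (u : H) : `|u| ^+ 2 = dot u u.
Proof.
rewrite norm_dot sqr_sqrtr//; have [->|u0] := eqVneq u 0.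
  by rewrite linear0r.
by rewrite ltW// neq0_dnorm_gt0.
Qed.

(** The perpendicular bisector of the segment from 0 to [a] is an affine
    hyperplane: the quadratic terms in [w] cancel. *)
Lemma eq_normB (w a : H) : `|w - a| = `|w| <-> dot a w = 2^-1 * `|a| ^+ 2.
Proof.
have normB2 : `|w - a| ^+ 2 = `|w| ^+ 2 + (`|a| ^+ 2 - 2 * dot a w).
  rewrite !sqr_norm_dot linearBl !linearBr/= (dot_sym dot w a).
  by rewrite mulr_natl mulr2n !opprD opprK addrACA -!addrA addrC; ring.
split=> [ewa|awE].
  move: normB2; rewrite ewa -[LHS]addr0 => /addrI/esym/eqP.
  by rewrite subr_eq0 => /eqP ->; rewrite mulKf ?pnatr_eq0.
apply/eqP; rewrite -(eqrXn2 (n := 2))// normB2 awE mulVKf ?pnatr_eq0//.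
by rewrite subrr addr0.
Qed.

(** Comparing the distances to [x ord0] and to each other [x i] is enough, so
    the common radius disappears from the condition, and [eq_normB] makes each
    comparison one row of a linear system. *)
Lemma is_circumcenter_rangeP n (x : 'I_n.+1 -> H) (q : H) :
  let d := fun i : 'I_n => x (lift ord0 i) - x ord0 in
  is_circumcenter (range x) q <->
  exists2 c, q = x ord0 + lincomb d c &
    gram dot d *m c = 2^-1 *: \col_(i < n) `|d i| ^+ 2.
Proof.
move=> d.
have distE w i : x ord0 + w - x (lift ord0 i) = w - d i.
  by rewrite /d opprB addrA (addrC w).
have dist0 w : x ord0 + w - x ord0 = w by rewrite addrC addKr.
split.
  rewrite /is_circumcenter (aff_rangeE x) => -[[c _ <-] [r rE]]; exists c => //.
  have distr i : `|x ord0 + lincomb d c - x i| = r.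
    by rewrite -[_ = r]/([set r] _) -rE; exists (x i) => //; exists i.
  apply/colP => i; rewrite gram_mulmx !mxE; apply/eq_normB.
  by rewrite -distE distr -[in RHS](dist0 (lincomb d c)) distr.
case=> c -> cE; split; first by rewrite (aff_rangeE x); exists c.
exists `|lincomb d c|; apply/seteqP; split.
  move=> _ [_ [i _ <-] <-] /=; case: (unliftP ord0 i) => [j ->|->].
    by rewrite distE; apply/eq_normB; rewrite -gram_mulmx cE !mxE.
  by rewrite dist0.
by move=> _ ->; exists (x ord0); [exists ord0|rewrite dist0].
Qed.

End Circumcenters.

(* The real Hilbert space is the complete normed module H whose norm is induced
   by the inner product dot. The number of points is m = n.+1; x_1 is x ord0 and
   x_2, ..., x_m are the x (lift ord0 i) for i : 'I_n. *)
Theorem theorem4p1 (R : realType) (H : completeNormedModType R)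
    (dot : {dot H for idfun})
    (norm_dot : forall u : H, `|u| = Num.sqrt (dot u u))
    (n : nat) (m_ge2 : (2 <= n.+1)%N)
    (x : 'I_n.+1 -> H) (x_indep : aff_independent x) :
  let S : set H := range x in
  let d : 'I_n -> H := fun i => x (lift ord0 i) - x ord0 in
  let G : 'M[R]_n := gram dot d in
  exists p : H,
    [/\ CC S = Some p,
        is_circumcenter S p,
        (forall q : H, is_circumcenter S q -> q = p),
        G \in unitmx &
        p = x ord0 + 2^-1 *: lincomb d (invmx G *m \col_(i < n) `|d i| ^+ 2)].
Proof.
move=> S d G.
have G_unit : G \in unitmx := gram_unit dot (aff_independent_lin x_indep).
set e := \col_i _.
pose p := x ord0 + 2^-1 *: lincomb d (invmx G *m e).
have p_center : is_circumcenter S p.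
  apply/(is_circumcenter_rangeP norm_dot).
  exists (2^-1 *: (invmx G *m e)); first by rewrite lincombZ.
  by rewrite -scalemxAr mulKVmx.
have p_uniq q : is_circumcenter S q -> q = p.
  move=> /(is_circumcenter_rangeP norm_dot)[c -> cE].
  by rewrite /p -lincombZ scalemxAr -[2^-1 *: e]cE mulKmx.
exists p; split=> //.
rewrite /CC; case: pselect => [ex_p|]; last by case; exists p.
by congr Some; apply: p_uniq; exact: projT2.
Qed.
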